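(* Let $1\le K\le P$ be integers and let the times taken by each of $P$ workers to compute the gradient on one mini-batch be i.i.d. (across workers and mini-batches) with a new-longer-than-used distribution; let $X_1,\dots,X_P$ denote i.i.d. copies. Then the expected runtime per iteration of $K$-async SGD (i.e. the expected duration of any iteration) satisfies $$\mathbb{E}[T]\le \mathbb{E}[X_{K:P}],$$ where $X_{K:P}$ is the $K$-th order statistic ($K$-th smallest) of $X_1,\dots,X_P$.
   Context: A (nonnegative) random variable $U$ has a new-longer-than-used distribution if $\Pr(U>u+t\mid U>t)\le \Pr(U>u)$ for all $t,u\ge 0$ (whenever the conditional probability is defined). A central parameter server (PS) interacts with $P$ parallel workers, all starting at time $0$; everything other than gradient computation takes zero time. $K$-async SGD: each worker computes the gradient on one mini-batch; the PS updates the parameter when $K$ of the $P$ workers have finished (a worker that has finished idles until the update). At the update these $K$ workers start computing on fresh mini-batches, while the other $P-K$ workers are not cancelled and continue their ongoing computations. An iteration is the period between two consecutive updates, and $T$ is its duration. *)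

(* Defs.v *)
From mathcomp Require Import all_boot all_order all_algebra all_fingroup.
From mathcomp Require Import all_classical all_reals all_analysis.

Set Implicit Arguments.
Unset Strict Implicit.
Unset Printing Implicit Defensive.

Import Order.TTheory GRing.Theory Num.Theory.
Local Open Scope classical_set_scope.
Local Open Scope ring_scope.

Definition cond_prob d (T : measurableType d) (R : realType)
    (Pr : probability T R) (A B : set T) : \bar R :=
  (Pr (A `&` B) / Pr B)%E.

Definition new_longer_than_used d (T : measurableType d) (R : realType)
    (Pr : probability T R) (U : {RV Pr >-> R}) : Prop :=
  {ae Pr, forall x, 0 <= U x} /\
  forall t u : R, 0 <= t -> 0 <= u ->
    Pr [set x | t < U x] != 0%E ->
    (cond_prob Pr [set x | (u + t < U x)%R] [set x | (t < U x)%R]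
       <= Pr [set x | (u < U x)%R])%E.

Definition mutually_independent d (T : measurableType d) (R : realType)
    (Pr : probability T R) (I : eqType) (X : I -> {RV Pr >-> R}) : Prop :=
  forall (s : seq I) (B : I -> set R), uniq s ->
    (forall i, measurable (B i)) ->
    Pr (\bigcap_(i in [set` s]) (X i @^-1` B i)) =
      (\prod_(i <- s) Pr (X i @^-1` B i))%E.

Definition same_distribution d (T : measurableType d) d' (T' : measurableType d')
    (R : realType) (Pr : probability T R) (Pr' : probability T' R)
    (U : {RV Pr >-> R}) (V : {RV Pr' >-> R}) : Prop :=
  forall B : set R, measurable B -> distribution Pr U B = distribution Pr' V B.

Definition iid d (T : measurableType d) (R : realType)
    (Pr : probability T R) (I : eqType) (X : I -> {RV Pr >-> R}) : Prop :=
  mutually_independent X /\ forall i j, same_distribution (X i) (X j).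

(* The K-th smallest value, with K counted from 1. *)
Definition order_statistic (R : realDomainType) (P K : nat) (x : 'I_P -> R) : R :=
  nth 0 (sort <=%R [seq x w | w <- enum 'I_P]) K.-1.

(* State right after an update (or at time 0): [batch w] is the index of the
   mini-batch worker w is processing and [start w] the time it began it. *)
Record async_state (R : Type) (P : nat) := AsyncState {
  now : R;
  batch : 'I_P -> nat;
  start : 'I_P -> R }.

Definition async_init (R : realDomainType) (P : nat) : async_state R P :=
  AsyncState 0 (fun=> 0%N) (fun=> 0).

Section KAsync.
Variables (R : realDomainType) (P K : nat).
(* [x w m] is the time worker w needs for its m-th mini-batch. *)
Variable x : 'I_P -> nat -> R.
(* Exactly K finished workers enter an update.  When several workers finish at
   the same instant, [tie b] is the order of preference among them; it may
   depend on how many mini-batches each worker has contributed so far (hence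
   also on the iteration number), but not on computation times. *)
Variable tie : ('I_P -> nat) -> {perm 'I_P}.

Definition finish_time (s : async_state R P) (w : 'I_P) : R :=
  start s w + x w (batch s w).

(* [sort] is stable, so equal finish times keep the order of [tie]. *)
Definition first_finishers (s : async_state R P) : seq 'I_P :=
  take K (sort (relpre (finish_time s) <=%R)
               [seq tie (batch s) w | w <- enum 'I_P]).

Definition async_update (s : async_state R P) : async_state R P :=
  let t := order_statistic K (finish_time s) in
  AsyncState t
    (fun w => if w \in first_finishers s then (batch s w).+1 else batch s w)
    (fun w => if w \in first_finishers s then t else start s w).

Definition async_run (j : nat) : async_state R P :=
  iter j async_update (async_init R P).

Definition iteration_runtime (j : nat) : R :=
  now (async_run j.+1) - now (async_run j).

End KAsync.

(* Main.v *)
Require Import Defs.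
From mathcomp Require Import all_boot all_order all_algebra all_fingroup.
From mathcomp Require Import all_classical all_reals all_analysis.
From mathcomp Require Import measurable_realfun ring.

Set Implicit Arguments.
Unset Strict Implicit.
Unset Printing Implicit Defensive.

Import Order.TTheory GRing.Theory Num.Theory.
Local Open Scope classical_set_scope.
Local Open Scope ring_scope.

(* It suffices to compare tails: Pr(T > t) <= Pr(X_{K:P} > t) for t >= 0, where
   T > t means that fewer than K workers finish within t after the update.
   Let Z_w say that the residual time of worker w at the update exceeds t.  Fix
   w and the index m of its current mini-batch, and freeze every computation
   time except x = x(w, m).  The state at the update does not depend on x as
   long as w has not finished mini-batch m; with a the age of that mini-batch,
   every x > a is such a value, whereas Z_w means x > t + a.  Since
   Pr(X > t + a) <= Pr(X > t) Pr(X > a), integrating over the frozen times gives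
   Pr(Z_w = 1, Z_v = z_v for v <> w) <= Pr(X > t) Pr(Z_v = z_v for v <> w).
   This makes the vector Z stochastically smaller than a vector of independent
   Bernoulli(Pr(X > t)) variables, by resampling one coordinate at a time. *)

(** * Stable sorting and order statistics *)

Lemma relpre_le_total (T : Type) (R : realDomainType) (f : T -> R) :
  total (relpre f <=%R).
Proof. by move=> x y; apply: le_total. Qed.

Lemma relpre_le_trans (T : Type) (R : realDomainType) (f : T -> R) :
  transitive (relpre f <=%R).
Proof. by move=> x y z; apply: le_trans. Qed.

Lemma take_filter_predC1 (T : eqType) (K : nat) (s : seq T) (w : T) :
  w \notin take K s -> take K [seq v <- s | v != w] = take K s.
Proof.
move=> wK; rewrite -{1}(cat_take_drop K s) filter_cat.
have /all_filterP -> : all (predC1 w) (take K s).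
  by apply/allP => v vK /=; apply: contraNneq wK => <-.
have [Ks|sK] := leqP K (size s); first by rewrite takel_cat ?size_takel// take_takel.
by rewrite (drop_oversize (ltnW sK)) cats0 take_takel.
Qed.

(* Deleting [w] commutes with the stable sort, and the first [K] elements do
   not change when an element outside them is deleted. *)
Lemma take_sort_off (T : eqType) (R : realDomainType) (f g : T -> R) (K : nat)
    (s : seq T) (w : T) :
    {in predC1 w, f =1 g} ->
    w \notin take K (sort (relpre f <=%R) s) ->
    w \notin take K (sort (relpre g <=%R) s) ->
  take K (sort (relpre f <=%R) s) = take K (sort (relpre g <=%R) s).
Proof.
move=> fg wf wg; rewrite -(take_filter_predC1 wf) -(take_filter_predC1 wg).
rewrite !filter_sort; try exact: relpre_le_total; try exact: relpre_le_trans.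
congr take; have /all_sigP[s' ->] := filter_all (predC1 w) s.
rewrite !sort_map; congr (map _ (sort _ _)).
by apply/funext => u; apply/funext => v /=; rewrite !fg//; apply: valP.
Qed.

(** If [w] were among the first [K] for [g], each of the [K] elements selected by [f] would precede
    it, giving [K.+1] distinct elements in a list of length [K]. The strict inequality makes the tie
    order irrelevant. *)
Lemma notin_take_sort (T : eqType) (R : realDomainType) (f g : T -> R) (K : nat)
    (s : seq T) (w : T) :
    uniq s -> (K <= size s)%N -> {in predC1 w, f =1 g} ->
    w \notin take K (sort (relpre f <=%R) s) ->
    {in take K (sort (relpre f <=%R) s), forall v, f v < g w} ->
  w \notin take K (sort (relpre g <=%R) s).
Proof.
move=> us Ks fg wf lt_w; apply/negP => wg.
set A := take K _ in wf lt_w; set B := take K _ in wg.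
have uB : uniq B by rewrite take_uniq// sort_uniq.
have uA : uniq A by rewrite take_uniq// sort_uniq.
have sA : size A = K by rewrite size_takel// size_sort.
have sB : size B = K by rewrite size_takel// size_sort.
have AB : {subset A <= B}.
  move=> v vA; have vs : v \in sort (relpre g <=%R) s.
    by rewrite mem_sort -(mem_sort (relpre f <=%R)); apply: mem_take vA.
  have vw : v != w by apply: contraNneq wf => <-.
  have := lt_w v vA; rewrite fg// ltNge => /negP lt_gw.
  move: vs; rewrite -(cat_take_drop K (sort _ s)) mem_cat => /orP[//|vD].
  exfalso; apply: lt_gw.
  have := sort_sorted (relpre_le_total g) s.
  rewrite -(cat_take_drop K (sort _ s)) (sorted_pairwise (@relpre_le_trans _ _ g)).
  by rewrite pairwise_cat => /and3P[/allrelP/(_ w v wg vD)].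
have : (size (w :: A) <= size B)%N.
  apply: uniq_leq_size; first by rewrite /= wf.
  by move=> v; rewrite inE => /predU1P[->//|/AB].
by rewrite /= sA sB ltnn.
Qed.

Section OrderStatistic.
Variables (R : realDomainType) (P K : nat).
Hypothesis hK : (1 <= K <= P)%N.
Implicit Type f : 'I_P -> R.

(** The sorted list of values does not depend on the order in which ties are presented, so the
    update time can be read off [first_finishers]. *)
Lemma order_statistic_take f (p : {perm 'I_P}) :
  order_statistic K f =
    nth 0 [seq f w | w <- take K (sort (relpre f <=%R) [seq p w | w <- enum 'I_P])]
      K.-1.
Proof.
have /andP[K0 KP] := hK.
rewrite /order_statistic map_take nth_take ?prednK// -sort_map.
congr nth; apply/perm_sortP; [exact: le_total|exact: le_trans|exact: le_anti|].
apply: perm_map.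
apply: uniq_perm; rewrite ?enum_uniq//.
  by rewrite map_inj_uniq ?enum_uniq//; apply: perm_inj.
move=> w; rewrite mem_enum; apply/esym/mapP.
by exists ((p^-1)%g w); rewrite ?mem_enum// permKV.
Qed.

Lemma order_statistic_le f c :
  (order_statistic K f <= c) = (K <= #|[pred w | (f w <= c)%R]|)%N.
Proof.
have /andP[K0 KP] := hK.
have ss : sorted <=%R (sort <=%R [seq f w | w <- enum 'I_P]).
  by apply: sort_sorted; apply: le_total.
have cE : count (<= c) (sort <=%R [seq f w | w <- enum 'I_P])
    = #|[pred w | (f w <= c)%R]|.
  by rewrite count_sort count_map cardE size_filter -enumT.
rewrite -cE; apply/idP/idP => [|cK].
  apply: contraTT; rewrite -ltnNge -ltNge => cK.
  apply: nth_count_gt; first by [].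
  by rewrite size_sort size_map size_enum_ord -ltnS prednK// cK.
apply: nth_count_le; first by [].
by rewrite prednK.
Qed.
End OrderStatistic.

Lemma order_statistic_bounds (R : realDomainType) (P K : nat)
    (hK : (1 <= K <= P)%N) (f : 'I_P -> R) (p : {perm 'I_P}) (w : 'I_P) :
  if w \in take K (sort (relpre f <=%R) [seq p v | v <- enum 'I_P])
  then f w <= order_statistic K f else order_statistic K f <= f w.
Proof.
have /andP[K0 KP] := hK.
set s := [seq p v | v <- enum 'I_P]; set S := sort _ s.
have sS : size S = P by rewrite size_sort size_map size_enum_ord.
have ws : w \in S.
  by rewrite mem_sort; apply/mapP; exists ((p^-1)%g w); rewrite ?mem_enum// permKV.
have ssf : sorted <=%R [seq f v | v <- S].
  by rewrite -sort_map; apply: sort_sorted; apply: le_total.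
have iS : (index w S < size S)%N by rewrite index_mem.
rewrite (order_statistic_take hK f p) -/s -/S map_take nth_take ?prednK//.
have -> : f w = nth 0 [seq f v | v <- S] (index w S).
  by rewrite (nth_map w) ?nth_index.
have KS : (K.-1 < size S)%N by rewrite sS prednK.
have sfS : size [seq f v | v <- S] = size S by rewrite size_map.
rewrite in_take//; case: ltnP => iK; apply: le_sorted_leq_nth => //=;
  rewrite ?inE ?sfS//.
- by rewrite -ltnS prednK.
- by rewrite (leq_trans (leq_pred _)).
Qed.

Lemma order_statistic_attained (R : realDomainType) (P K : nat)
    (hK : (1 <= K <= P)%N) (f : 'I_P -> R) :
  exists w, order_statistic K f = f w.
Proof.
have /andP[K0 KP] := hK.
have : order_statistic K f \in sort <=%R [seq f w | w <- enum 'I_P].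
  by rewrite mem_nth// size_sort size_map size_enum_ord prednK.
by rewrite mem_sort => /mapP[w _ ->]; exists w.
Qed.

(** * Sensitivity of the run to one computation time *)

Section Run.
Variables (R : realDomainType) (P K : nat).
Hypothesis hK : (1 <= K <= P)%N.
Variable tie : ('I_P -> nat) -> {perm 'I_P}.
Implicit Types (x : 'I_P -> nat -> R) (w : 'I_P).
Local Notation run x j := (async_run K x tie j).

Lemma async_runS x j : run x j.+1 = async_update K x tie (run x j).
Proof. by []. Qed.

Lemma batch_async_runS x j w : batch (run x j.+1) w =
  (batch (run x j) w + (w \in first_finishers K x tie (run x j)))%N.
Proof. by rewrite async_runS /=; case: ifP; rewrite ?addn1 ?addn0. Qed.

Lemma batch_async_run_homo x w i j :
  (i <= j)%N -> (batch (run x i) w <= batch (run x j) w)%N.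
Proof.
elim: j => [|j IH]; first by rewrite leqn0 => /eqP ->.
rewrite leq_eqVlt => /predU1P[->//|]; rewrite ltnS => /IH /leq_trans -> //.
by rewrite batch_async_runS leq_addr.
Qed.

Lemma batch_async_run_le x w j : (batch (run x j) w <= j)%N.
Proof.
by elim: j => [|j IH] //; rewrite batch_async_runS -addn1 leq_add//; case: (_ \in _).
Qed.

(** Counters never decrease, so a selection at step [i] would leave a lasting increase. *)
Lemma notin_first_finishers x w i j : (i < j)%N ->
  batch (run x i) w = batch (run x j) w ->
  w \notin first_finishers K x tie (run x i).
Proof.
move=> ij bij; apply/negP => wF; have := batch_async_run_homo x w ij.
by rewrite batch_async_runS wF -bij addn1 ltnn.
Qed.

Lemma start_async_run_eq x w i j : (i <= j)%N ->
  batch (run x i) w = batch (run x j) w -> start (run x j) w = start (run x i) w.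
Proof.
elim: j => [|j IH]; first by rewrite leqn0 => /eqP ->.
rewrite leq_eqVlt => /predU1P[->//|]; rewrite ltnS => ij bij.
have bj : batch (run x i) w = batch (run x j) w.
  apply/eqP; rewrite eqn_leq batch_async_run_homo//= bij.
  exact: batch_async_run_homo.
have /negPf wF := @notin_first_finishers x w j j.+1 (leqnn _) (etrans (esym bj) bij).
by rewrite async_runS /= wF IH.
Qed.

Section Nonneg.
Variable x : 'I_P -> nat -> R.
Hypothesis x0 : forall w m, 0 <= x w m.

(** Induction on [j]: a selected worker restarts at the new update time, and an unselected one
    finishes no earlier than the [K]-th smallest finish time. *)
Lemma async_run_inv j w :
  start (run x j) w <= now (run x j) <= finish_time x (run x j) w.
Proof.
elim: j w => [|j IH] w; first by rewrite /= lexx /finish_time add0r x0.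
have bnd := order_statistic_bounds hK (finish_time x (run x j))
  (tie (batch (run x j))).
rewrite async_runS /finish_time /=; have := bnd w; rewrite -/(first_finishers K x tie _).
case: ifP => wF le_t; first by rewrite lexx lerDl x0.
rewrite le_t andbT; have /andP[/le_trans + _] := IH w; apply.
have [v ->] := order_statistic_attained hK (finish_time x (run x j)).
by have /andP[] := IH v.
Qed.

Lemma now_async_run_homo i j : (i <= j)%N -> now (run x i) <= now (run x j).
Proof.
elim: j => [|j IH]; first by rewrite leqn0 => /eqP ->.
rewrite leq_eqVlt => /predU1P[->//|]; rewrite ltnS => /IH /le_trans; apply.
rewrite async_runS /=.
have [v ->] := order_statistic_attained hK (finish_time x (run x j)).
by have /andP[] := async_run_inv j v.
Qed.

Section Insensitive.
Variables (y : 'I_P -> nat -> R) (w : 'I_P) (m j : nat).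
Hypothesis xy : forall v n, (v, n) != (w, m) -> x v n = y v n.
Hypothesis bw : batch (run x j) w = m.

Let finish_timeE s v : (v, batch s v) != (w, m) -> finish_time x s v = finish_time y s v.
Proof. by move=> ?; rewrite /finish_time xy. Qed.

(** The altered time enters an update only through the finish time of [w] while it is on mini-batch
    [m]. If neither family selects [w] then, the two selections coincide, and with them the update
    time. *)
Let async_update_eq s : (batch s w = m ->
    w \notin first_finishers K x tie s /\ w \notin first_finishers K y tie s) ->
  async_update K x tie s = async_update K y tie s.
Proof.
move=> wF; suff [FE oE] : first_finishers K x tie s = first_finishers K y tie s /\
    order_statistic K (finish_time x s) = order_statistic K (finish_time y s).
  by rewrite /async_update FE oE.
have [/wF[wx wy]|bm] := eqVneq (batch s w) m; last first.
  suff fE : finish_time x s = finish_time y s by rewrite /first_finishers fE.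
  apply/funext => v; apply: finish_timeE.
  by apply: contraNneq bm => -[-> ->].
have fE : {in predC1 w, finish_time x s =1 finish_time y s}.
  by move=> v /= vw; apply: finish_timeE; apply: contraNneq vw => -[-> _].
have FE : first_finishers K x tie s = first_finishers K y tie s.
  exact: take_sort_off fE wx wy.
split=> //; rewrite !(order_statistic_take hK _ (tie (batch s))).
rewrite -!/(first_finishers K _ tie s) -FE; congr nth; apply/eq_in_map => v vx.
by rewrite fE// inE; apply: contraNneq wx => <-.
Qed.

(** As both runs have [w] on mini-batch [m] at step [j], neither has selected it from that
    mini-batch before, so every earlier update ignores the altered time. *)
Lemma async_run_eq_batch : batch (run y j) w = m -> run y j = run x j.
Proof.
move=> byw; suff H i : (i <= j)%N -> run y i = run x i by exact: H.
elim: i => [//|i IH] ij; rewrite !async_runS IH ?(ltnW ij)//; symmetry.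
apply: async_update_eq => bi; split.
  by apply: (notin_first_finishers ij); rewrite bi bw.
by rewrite -IH ?(ltnW ij)//; apply: (notin_first_finishers ij); rewrite byw IH// ltnW.
Qed.

(** Every worker selected before step [j] finishes by [now (run x j)], strictly before [w] would
    finish mini-batch [m] under [y]; hence [y] does not select [w] from it either. *)
Lemma async_run_eq_late :
  now (run x j) - start (run x j) w < y w m -> run y j = run x j.
Proof.
move=> late; suff H i : (i <= j)%N -> run y i = run x i by exact: H.
elim: i => [//|i IH] ij; rewrite !async_runS IH ?(ltnW ij)//; symmetry.
apply: async_update_eq => bi.
have wx : w \notin first_finishers K x tie (run x i).
  by apply: (notin_first_finishers ij); rewrite bi bw.
split=> //; apply: notin_take_sort (wx) _.
- by rewrite map_inj_uniq ?enum_uniq//; apply: perm_inj.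
- by rewrite size_map size_enum_ord; case/andP: hK.
- by move=> v /= vw; apply: finish_timeE; apply: contraNneq vw => -[-> _].
move=> v vF; have := order_statistic_bounds hK (finish_time x (run x i))
  (tie (batch (run x i))) v.
rewrite vF => /le_lt_trans; apply.
apply: le_lt_trans (now_async_run_homo ij) _.
by rewrite /finish_time bi -(start_async_run_eq (ltnW ij)) ?bi ?bw// -ltrBlDl.
Qed.

End Insensitive.
End Nonneg.
End Run.

(** * Comparison with independent Bernoulli variables *)

Section Coupling.
Variables (R : realFieldType) (I : finType) (p : R).
Implicit Types (z : {ffun I -> bool}) (F q : {ffun I -> bool} -> R).

Definition upd z w b : {ffun I -> bool} :=
  [ffun v => if v == w then b else z v].

(** The mean of [F] once coordinate [w] is replaced by an independent Bernoulli([p]) variable. *)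
Definition resample w F z : R := p * F (upd z w true) + (1 - p) * F (upd z w false).

Definition nondecr F :=
  forall z z', (forall w, z w ==> z' w) -> F z <= F z'.

(** Flipping coordinate [w] is an involution, and [z] with its flip form the pair of updates of
    [z]. *)
Lemma sum_upd w F :
  2 * \sum_z F z = \sum_z (F (upd z w true) + F (upd z w false)).
Proof.
pose flip z := upd z w (~~ z w).
have flipK : involutive flip.
  move=> z; apply/ffunP => v; rewrite !ffunE eqxx.
  by case: eqP => // ->; rewrite negbK.
have -> : 2 * \sum_z F z = \sum_z (F z + F (flip z)).
  by rewrite big_split/= mulr_natl mulr2n {2}(reindex_inj (inv_inj flipK)).
apply: eq_bigr => z _; have zE : z = upd z w (z w).
  by apply/ffunP => v; rewrite ffunE; case: eqP => // ->.
by rewrite {1}zE /flip; case: (z w) => //=; rewrite addrC.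
Qed.

Lemma upd_upd z w b c : upd (upd z w b) w c = upd z w c.
Proof. by apply/ffunP => v; rewrite !ffunE; case: eqP. Qed.

(** Isolates the effect of one resampling: the first factor has the sign of the comparison between
    [q] and Bernoulli([p]) at [w], the second is nonnegative when [F] is nondecreasing. *)
Lemma sum_resample w F q :
  2 * (\sum_z q z * resample w F z - \sum_z q z * F z) =
  \sum_z (p * (q (upd z w true) + q (upd z w false)) - q (upd z w true)) *
         (F (upd z w true) - F (upd z w false)).
Proof.
rewrite mulrBr !(sum_upd w) -sumrB; apply: eq_bigr => z _.
by rewrite /resample !upd_upd; ring.
Qed.

Lemma resample_nondecr w F : 0 <= p <= 1 -> nondecr F -> nondecr (resample w F).
Proof.
move=> /andP[p0 p1] FI z z' zz'; rewrite lerD// ler_wpM2l ?subr_ge0//; apply: FI => v;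
  by rewrite !ffunE; case: eqP.
Qed.

Lemma resample_all_const (s : seq I) F z z' :
  (forall v, v \notin s -> z v = z' v) ->
  foldr resample F s z = foldr resample F s z'.
Proof.
elim: s z z' => [|w s IH] z z' zz' /=.
  by congr F; apply/ffunP => v; apply: zz'.
by congr (_ * _ + _ * _); apply: IH => v vs; rewrite !ffunE;
  case: eqP => // /eqP vw; apply: zz'; rewrite inE negb_or vw.
Qed.

(* Resampling one coordinate at a time increases the mean of a nondecreasing
   function under [q] and decreases it under [q']; once all the coordinates are
   resampled the function is constant. *)
Lemma le_mean_nondecr F q q' : 0 <= p <= 1 -> nondecr F ->
    (forall w z, q (upd z w true) <= p * (q (upd z w true) + q (upd z w false))) ->
    (forall w z, p * (q' (upd z w true) + q' (upd z w false)) <= q' (upd z w true)) ->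
    \sum_z q z = 1 -> \sum_z q' z = 1 ->
  \sum_z q z * F z <= \sum_z q' z * F z.
Proof.
move=> p01 FI hq hq' q1 q'1.
have Fs s : nondecr (foldr resample F s).
  by elim: s => //= w s; apply: resample_nondecr.
have dF w s z : 0 <= foldr resample F s (upd z w true) - foldr resample F s (upd z w false).
  rewrite subr_ge0; apply: Fs => v; rewrite !ffunE; case: eqP => //= _.
  by rewrite implybb.
pose c := foldr resample F (enum I) [ffun=> false].
have cE z : foldr resample F (enum I) z = c.
  by apply: resample_all_const => v; rewrite mem_enum.
have le_c s : \sum_z q z * F z <= \sum_z q z * foldr resample F s z.
  elim: s => //= w s /le_trans; apply; rewrite -subr_ge0.
  rewrite -(pmulr_rge0 _ (ltr0n _ 2)) sum_resample; apply: sumr_ge0 => z _.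
  by rewrite mulr_ge0// subr_ge0.
have ge_c s : \sum_z q' z * foldr resample F s z <= \sum_z q' z * F z.
  elim: s => //= w s; apply: le_trans; rewrite -subr_le0.
  rewrite -(pmulr_rle0 _ (ltr0n _ 2)) sum_resample; apply: sumr_le0 => z _.
  by rewrite mulr_le0_ge0// subr_le0.
apply: le_trans (le_c (enum I)) _; apply: le_trans (ge_c (enum I)).
under eq_bigr do rewrite cE; under [leRHS]eq_bigr do rewrite cE.
by rewrite -!mulr_suml q1 q'1.
Qed.

End Coupling.

(** * Measurability *)

Section DiscreteMeasurability.
Variables (d : measure_display) (T : measurableType d).

(** Measurability for maps into countable types, such as counter vectors and comparison tables,
    phrased without a sigma-algebra on the target. *)
Definition fibers_measurable (C : Type) (f : T -> C) :=
  forall c, measurable (f @^-1` [set c]).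

Lemma measurable_discrete_case (C : countType) (f : T -> C) (A : C -> set T) :
  fibers_measurable f -> (forall c, measurable (A c)) ->
  measurable [set t | A (f t) t].
Proof.
move=> mf mA.
have -> : [set t | A (f t) t] = \bigcup_c (f @^-1` [set c] `&` A c).
  by apply/seteqP; split => [t At|t [c _ [/= <-]]//]; exists (f t).
apply: countable_bigcupT_measurable; first exact: countableP.
by move=> c; apply: measurableI.
Qed.

Lemma measurable_cst_set (Q : Prop) : measurable [set _ : T | Q].
Proof.
have [q|q] := pselect Q.
  by rewrite (_ : [set _ | _] = setT)//; apply/seteqP; split.
by rewrite (_ : [set _ | _] = set0)//; apply/seteqP; split.
Qed.

Lemma measurable_fun_discrete_case d' (T' : measurableType d') (C : countType)
    (f : T -> C) (g : C -> T -> T') :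
  fibers_measurable f -> (forall c, measurable_fun setT (g c)) ->
  measurable_fun setT (fun t => g (f t) t).
Proof.
move=> mf mg _ Y mY; rewrite setTI.
apply: (measurable_discrete_case (A := fun c => g c @^-1` Y)) => // c.
by rewrite -[X in measurable X]setTI; apply: mg.
Qed.

Lemma fibers_measurable_preimage (C : countType) (f : T -> C) (B : set C) :
  fibers_measurable f -> measurable (f @^-1` B).
Proof.
move=> mf; apply: (measurable_discrete_case (A := fun c => [set _ | B c])) => // c.
exact: measurable_cst_set.
Qed.

Lemma fibers_measurable_comp (C : countType) (C' : Type) (f : T -> C) (g : C -> C') :
  fibers_measurable f -> fibers_measurable (fun t => g (f t)).
Proof. by move=> mf c; apply: (fibers_measurable_preimage (g @^-1` [set c])). Qed.

Lemma fibers_measurable_pair (C C' : Type) (f : T -> C) (g : T -> C') :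
  fibers_measurable f -> fibers_measurable g ->
  fibers_measurable (fun t => (f t, g t)).
Proof.
move=> mf mg [c c'].
rewrite (_ : _ @^-1` _ = f @^-1` [set c] `&` g @^-1` [set c']); first exact: measurableI.
by apply/seteqP; split => t /= => [[]//|[-> ->]].
Qed.

Lemma fibers_measurable_ffun (I : finType) (C : Type) (f : I -> T -> C) :
  (forall i, fibers_measurable (f i)) ->
  fibers_measurable (fun t => [ffun i => f i t]).
Proof.
move=> mf c; rewrite (_ : _ @^-1` _ = \bigcap_(i in [set: I]) (f i @^-1` [set c i])).
  by apply: fin_bigcap_measurable => // i _; apply: mf.
apply/seteqP; split => t /= => [<- i _|H]; first by rewrite /= ffunE.
by apply/ffunP => i; rewrite ffunE; apply: H.
Qed.

Lemma fibers_measurable_bool (f : T -> bool) :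
  measurable_fun setT f -> fibers_measurable f.
Proof. by move=> mf b; rewrite -[X in measurable X]setTI; apply: mf. Qed.

Section AsyncRun.
Variables (R : realType) (P K : nat).
Hypothesis hK : (1 <= K <= P)%N.

(** Sorting depends on [t] only through this table, which takes finitely many values. *)
Let comparisons (f : 'I_P -> T -> R) t : {ffun 'I_P * 'I_P -> bool} :=
  [ffun vw => f vw.1 t <= f vw.2 t].

Let fibers_measurable_comparisons f : (forall w, measurable_fun setT (f w)) ->
  fibers_measurable (comparisons f).
Proof.
move=> mf; apply: fibers_measurable_ffun => vw.
by apply: fibers_measurable_bool; apply: measurable_fun_ler.
Qed.

Let relpre_comparisons f t : relpre (f ^~ t) <=%R = (fun v w => comparisons f t (v, w)) :> rel _.
Proof. by apply/funext => v; apply/funext => w; rewrite ffunE. Qed.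

Lemma measurable_order_statistic (f : 'I_P -> T -> R) :
  (forall w, measurable_fun setT (f w)) ->
  measurable_fun setT (fun t => order_statistic K (f ^~ t)).
Proof.
move=> mf; have /andP[K0 KP] := hK.
pose w0 := Ordinal (leq_trans K0 KP).
pose g (c : {ffun 'I_P * 'I_P -> bool}) t :=
  f (nth w0 (sort (fun v w => c (v, w)) (enum 'I_P)) K.-1) t.
rewrite (_ : (fun t => _) = fun t => g (comparisons f t) t).
  apply: (measurable_fun_discrete_case (g := g)); last by move=> c; apply: mf.
  exact: fibers_measurable_comparisons.
apply/funext => t; rewrite /order_statistic sort_map (nth_map w0).
  by rewrite relpre_comparisons.
by rewrite size_sort size_enum_ord prednK.
Qed.

Variables (tie : ('I_P -> nat) -> {perm 'I_P}) (x : 'I_P -> nat -> T -> R).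
Hypothesis mx : forall w m, measurable_fun setT (x w m).
Local Notation run t j := (async_run K (fun w m => x w m t) tie j).

Lemma measurable_finish_time (s : T -> async_state R P) w :
    fibers_measurable (fun t => [ffun v => batch (s t) v]) ->
    measurable_fun setT (fun t => start (s t) w) ->
  measurable_fun setT (fun t => finish_time (fun w m => x w m t) (s t) w).
Proof.
move=> mb ms; rewrite (_ : (fun t => _) = fun t =>
    start (s t) w + x w ([ffun v => batch (s t) v] w) t).
  apply: (measurable_fun_discrete_case
    (g := fun (b : {ffun 'I_P -> nat}) t => start (s t) w + x w (b w) t)) => // b.
  exact: measurable_funD.
by apply/funext => t; rewrite /finish_time ffunE.
Qed.

(** Induction on [j]: the selection is a function of the counters and of the comparisons between
    finish times, and where this countable-valued pair is constant the next state is given by one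
    fixed measurable formula. Counters are packed as finite functions to get a countable type. *)
Lemma measurable_async_run j :
  [/\ measurable_fun setT (fun t => now (run t j)),
      fibers_measurable (fun t => [ffun w => batch (run t j) w]) &
      forall w, measurable_fun setT (fun t => start (run t j) w)].
Proof.
elim: j => [|j [mnow mbatch mstart]].
  split; [exact: measurable_cst| |by move=> w; exact: measurable_cst].
  by move=> c; exact: (measurable_cst_set ([ffun=> 0%N] = c)).
pose B t : {ffun 'I_P -> nat} := [ffun w => batch (run t j) w].
have BE t : batch (run t j) = B t by apply/funext => w; rewrite ffunE.
have mfin w : measurable_fun setT
    (fun t => finish_time (fun w m => x w m t) (run t j) w).
  exact: measurable_finish_time.
pose c t := comparisons (fun w t => finish_time (fun w m => x w m t) (run t j) w) t.
have mBc : fibers_measurable (fun t => (B t, c t)).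
  by apply: fibers_measurable_pair => //; apply: fibers_measurable_comparisons.
pose Fs (bc : {ffun 'I_P -> nat} * {ffun 'I_P * 'I_P -> bool}) : seq 'I_P :=
  take K (sort (fun v w => bc.2 (v, w)) [seq tie bc.1 w | w <- enum 'I_P]).
have FsE t : first_finishers K (fun w m => x w m t) tie (run t j) = Fs (B t, c t).
  by rewrite /first_finishers BE /Fs /= -relpre_comparisons.
have mnow' : measurable_fun setT (fun t => now (run t j.+1)).
  exact: measurable_order_statistic.
split=> //.
- pose g (bc : {ffun 'I_P -> nat} * {ffun 'I_P * 'I_P -> bool}) : {ffun 'I_P -> nat} :=
    [ffun w => if w \in Fs bc then (bc.1 w).+1 else bc.1 w].
  rewrite (_ : (fun t => _) = fun t => g (B t, c t)).
    exact: (fibers_measurable_comp g mBc).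
  apply/funext => t; apply/ffunP => w.
  by rewrite ffunE async_runS /= FsE [in RHS]ffunE /= BE.
- move=> w; pose g bc t := if w \in Fs bc then now (run t j.+1) else start (run t j) w.
  rewrite (_ : (fun t => _) = fun t => g (B t, c t) t).
    apply: (measurable_fun_discrete_case (g := g)) => // bc.
    by rewrite /g; case: (w \in Fs bc).
  by apply/funext => t; rewrite async_runS /= FsE /g.
Qed.

Lemma measurable_iteration_runtime j :
  measurable_fun setT (fun t => iteration_runtime K (fun w m => x w m t) tie j).
Proof.
by apply: measurable_funB; [have [] := measurable_async_run j.+1|have [] := measurable_async_run j].
Qed.
End AsyncRun.
End DiscreteMeasurability.

(** * Independence *)

Lemma mfunEx d d' (T : measurableType d) (T' : measurableType d') (f : T -> T') :
  measurable_fun setT f -> exists g : {mfun T >-> T'}, g = f :> (T -> T').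
Proof. by move=> mf; exists (mfun_Sub (mem_set mf)). Qed.

Section IndependentSections.
Context d (T : measurableType d) d1 (T1 : measurableType d1) (R : realType).
Variables (Pr : probability T R) (V : {mfun T >-> T1}) (U : {RV Pr >-> R}).

Hypothesis indep : forall A C, measurable A -> measurable C ->
  Pr (V @^-1` A `&` U @^-1` C) = (Pr (V @^-1` A) * Pr (U @^-1` C))%E.

(** By independence the law of [(V, U)] is the product of the two laws, so the inequality between
    sections integrates over the law of [V]. *)
Lemma le_probability_sections (B1 B2 : set (T1 * R)) (p : \bar R) : (0 <= p)%E ->
    measurable B1 -> measurable B2 ->
    (forall v, Pr (U @^-1` xsection B1 v) <= p * Pr (U @^-1` xsection B2 v))%E ->
  (Pr [set t | B1 (V t, U t)] <= p * Pr [set t | B2 (V t, U t)])%E.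
Proof.
move=> p0 mB1 mB2 B12.
have [W WE] : exists W : {mfun T >-> (T1 * R)%type}, W = (fun t => (V t, U t)) :> (T -> _).
  exact/mfunEx/measurable_fun_pair.
have PrE B : measurable B -> Pr [set t | B (V t, U t)] =
    (\int[distribution Pr V]_v distribution Pr U (xsection B v))%E.
  move=> mB; transitivity (distribution Pr W B).
    by rewrite /distribution /pushforward WE.
  rewrite -(product_measure_unique (m1 := distribution Pr V)
    (m2 := distribution Pr U) (m' := distribution Pr W))// => A C mA mC.
  by rewrite /= /distribution /pushforward WE -indep//.
rewrite !PrE// -ge0_integralZl//; last exact: measurable_fun_xsection.
apply: ge0_le_integral => //.
- exact: measurable_fun_xsection.
- apply/measurable_funeM; exact: measurable_fun_xsection.
- by move=> v _; apply: B12.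
Qed.

End IndependentSections.

(** * The sigma-algebra generated by all the variables but one *)

Section OtherVariables.
Context d (T : measurableType d) (R : realType).
Variables (Pr : probability T R) (I : choiceType) (X : I -> {RV Pr >-> R}).

Definition cylinders i : set (set T) :=
  [set A | exists s B, [/\ uniq s, i \notin s, forall k : I, measurable (B k : set R) &
    A = \bigcap_(k in [set` s]) (X k @^-1` B k)]].

Lemma cylinders_measurable i : cylinders i `<=` measurable.
Proof.
move=> _ [s [B [_ _ mB ->]]].
by apply: fin_bigcap_measurable => // k _; apply: measurable_funPTI.
Qed.

Lemma cylinders_setI_closed i : setI_closed (cylinders i).
Proof.
move=> _ _ [s [B [us si mB ->]]] [s' [B' [us' si' mB' ->]]].
exists (undup (s ++ s')), (fun k => (if k \in s then B k else setT) `&`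
  (if k \in s' then B' k else setT)); split.
- exact: undup_uniq.
- by rewrite mem_undup mem_cat negb_or si.
- by move=> k; apply: measurableI; case: ifP.
apply/seteqP; split => [t [H H'] k /=|t H].
  rewrite mem_undup mem_cat => _.
  by split; case: ifP => // ks; [apply: H|apply: H'].
split => k /= ks; have := H k; rewrite /= mem_undup mem_cat ks ?orbT => /(_ isT)[];
  by rewrite ?ks.
Qed.

Hypothesis hX : mutually_independent X.

(** As functions of [A], both sides are finite measures that agree on the pi-system [cylinders i],
    hence on the sigma-algebra it generates. *)
Lemma cylinders_indep i A C : <<s cylinders i >> A -> measurable C ->
  Pr (A `&` X i @^-1` C) = (Pr A * Pr (X i @^-1` C))%E.
Proof.
move=> sA mC; have mXC : measurable (X i @^-1` C) by exact: measurable_funPTI.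
have c0 : 0 <= fine (Pr (X i @^-1` C)) by rewrite fine_ge0.
have cE : (fine (Pr (X i @^-1` C)))%:E = Pr (X i @^-1` C) by rewrite fineK// fin_num_measure.
suff : mrestr Pr mXC A = mscale (NngNum c0) Pr A.
  by rewrite /mrestr /mscale /= cE muleC.
apply: (@g_sigma_algebra_measure_unique _ _ _ (cylinders i)
  (@cylinders_measurable i) (fun=> setT)) sA => //.
- by move=> _; exists [::], (fun=> setT); split=> //; apply/seteqP; split.
- by apply/seteqP; split => // t _; exists 0%N.
- exact: cylinders_setI_closed.
- move=> _ [s [B [us si mB ->]]].
  change (Pr (\bigcap_(k in [set` s]) (X k @^-1` B k) `&` X i @^-1` C) =
    ((fine (Pr (X i @^-1` C)))%:E * Pr (\bigcap_(k in [set` s]) (X k @^-1` B k)))%E).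
  rewrite cE muleC [X in (X * _)%E]hX//.
  (* Adding the constraint [C] at [i] gives an event over the duplicate-free list [i :: s], to which
     mutual independence applies again. *)
  pose B' k := if k == i then C else B k.
  rewrite (_ : _ `&` _ = \bigcap_(k in [set` i :: s]) (X k @^-1` B' k)); last first.
    apply/seteqP; split => [t [H Ht] k /=|t H].
      by rewrite inE /B'; case: eqP => [->//|_ /=]; apply: H.
    split=> [k /= ks|]; last by have := H i; rewrite /= /B' inE eqxx; apply.
    have := H k; rewrite /= /B' inE ks orbT => /(_ isT).
    by case: eqP si => // <-; rewrite ks.
  rewrite hX; first last.
  + by move=> k; rewrite /B'; case: ifP.
  + by rewrite /= si.
  rewrite big_cons /B' eqxx muleC; congr (_ * _)%E; apply: eq_big_seq => k ks.
  by case: eqP si => // <-; rewrite ks.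
- by move=> _; change (Pr (setT `&` X i @^-1` C) < +oo)%E; rewrite setTI (le_lt_trans (probability_le1 _ _)) ?ltry.
Qed.

End OtherVariables.

(** * Residual times *)

Section Outlasts.
Variables (R : realDomainType) (P K : nat).
Hypothesis hK : (1 <= K <= P)%N.
Variables (tie : ('I_P -> nat) -> {perm 'I_P}) (j : nat) (t : R).
Implicit Types (x : 'I_P -> nat -> R) (w : 'I_P).

Definition outlasts x : {ffun 'I_P -> bool} :=
  [ffun w => now (async_run K x tie j) + t < finish_time x (async_run K x tie j) w].

Lemma order_statistic_gt (g : 'I_P -> R) c :
  (c < order_statistic K g) = (#|[pred w | ~~ (c < g w)%R]| < K)%N.
Proof.
rewrite ltNge order_statistic_le// ltnNge; congr (~~ (_ <= _)%N).
by apply: eq_card => w; rewrite !inE leNgt.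
Qed.

(** The next update occurs at the [K]-th smallest finish time, so the event becomes a function of
    the boolean vector of residual times alone. *)
Lemma lt_iteration_runtime x :
  (t < iteration_runtime K x tie j) = (#|[pred w | ~~ outlasts x w]| < K)%N.
Proof.
rewrite /iteration_runtime async_runS /= ltrBrDl order_statistic_gt.
by congr (_ < _)%N; apply: eq_card => w; rewrite !inE ffunE.
Qed.

End Outlasts.

Lemma few_false_nondecr (R : realFieldType) (I : finType) (K : nat) :
  nondecr (fun z : {ffun I -> bool} => (#|[pred w | ~~ z w]| < K)%:R : R).
Proof.
move=> z z' zz'; rewrite ler_nat; case: (leqP K #|[pred w | ~~ z w]|) => // zK.
rewrite (leq_ltn_trans _ zK)//.
apply: subset_leq_card; apply/fintype.subsetP => w; rewrite !inE.
by apply: contra; apply: (implyP (zz' w)).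
Qed.

(** * Splitting a probability along a finite-valued map *)

Section FiniteSplit.
Context d (T : measurableType d) (R : realType) (Pr : probability T R).
Variables (C : finType) (f : T -> C).
Hypothesis mf : fibers_measurable f.

Lemma probability_finite_split (A : set T) : measurable A ->
  Pr A = (\sum_c Pr (A `&` (f @^-1` [set c])))%E.
Proof.
move=> mA; rewrite -big_enum (fsbig_seq _ _ (enum_uniq C)) -measure_fin_bigcup//.
- congr (Pr _); apply/seteqP; split => [u Au|u [c _ []//]].
  by exists (f u); rewrite //= mem_enum.
- by move=> c c' _ _ [u [[_ /= <-] [_ /= <-]]].
- by move=> c _; apply: measurableI.
Qed.

Lemma probability_discrete (B : pred C) :
  fine (Pr [set u | B (f u)]) = \sum_c fine (Pr (f @^-1` [set c])) * (B c)%:R.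
Proof.
have mB : measurable [set u | B (f u)].
  exact: (fibers_measurable_preimage [set c | B c]).
rewrite (probability_finite_split mB) -sum_fine; last first.
  by move=> c _; rewrite fin_num_measure//; apply: measurableI.
apply: eq_bigr => c _; case: (boolP (B c)) => Bc; rewrite ?mulr1 ?mulr0.
  by congr (fine (Pr _)); apply/seteqP; split => [u []//|u /= fu]; rewrite fu.
rewrite (_ : _ `&` _ = set0) ?measure0//.
by apply/seteqP; split => // u [/= + fu]; rewrite fu (negPf Bc).
Qed.

End FiniteSplit.

(** Product form of the hypothesis. When [t < U] has probability zero the conditional bound says
    nothing, but then the left side vanishes by inclusion. *)
Lemma new_longer_than_used_tail d (T : measurableType d) (R : realType)
    (Pr : probability T R) (U : {RV Pr >-> R}) (t u : R) :
    new_longer_than_used U -> 0 <= t -> 0 <= u ->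
  (Pr [set x | (u + t < U x)%R] <=
    Pr [set x | (u < U x)%R] * Pr [set x | (t < U x)%R])%E.
Proof.
move=> [_ nlu] t0 u0.
have mU a : measurable [set x | a < U x].
  have := @measurable_funPTI _ _ _ _ U `]a, +oo[%classic (measurable_itv _).
  by congr measurable; apply/seteqP; split => x /=; rewrite in_itv/= andbT.
have sub : [set x | u + t < U x] `<=` [set x | t < U x].
  by move=> x /=; apply: le_lt_trans; rewrite lerDr.
have [Pt0|Pt0] := eqVneq (Pr [set x | t < U x]) 0%E.
  by rewrite Pt0 mule0 -Pt0; apply: le_measure; rewrite ?inE.
have := nlu t u t0 u0 Pt0; rewrite /cond_prob setIidl//.
have fE : (fine (Pr [set x | t < U x]))%:E = Pr [set x | t < U x].
  by rewrite fineK// fin_num_measure.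
have f0 : 0 < fine (Pr [set x | t < U x]).
  by rewrite -lte_fin fE lt0e Pt0 measure_ge0.
by rewrite -fE inver gt_eqF// lee_pdivrMr.
Qed.

(** * Domination of one residual-time indicator given the others *)

Section Domination.
Variables (R : realType) (P K : nat).
Hypothesis hK : (1 <= K <= P)%N.
Variables (d : measure_display) (T : measurableType d) (Pr : probability T R).
Variable X : 'I_P * nat -> {RV Pr >-> R}.
Hypothesis hX : mutually_independent X.
Hypothesis hnl : forall i, new_longer_than_used (X i).
Variables (tie : ('I_P -> nat) -> {perm 'I_P}) (j : nat) (t : R) (p : \bar R).
Hypothesis t0 : 0 <= t.
Hypothesis hp : forall i, Pr [set u | t < X i u] = p.
Local Notation run x := (async_run K x tie j).
Local Notation outlasts x := (outlasts K tie j t x).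

Section MeasurableEvents.
Variables (d1 : measure_display) (T1 : measurableType d1) (x : 'I_P -> nat -> T1 -> R).
Hypothesis mx : forall w m, measurable_fun setT (x w m).
Local Notation xat u := (fun w m => x w m u).

Lemma fibers_measurable_outlasts : fibers_measurable (fun u => outlasts (xat u)).
Proof.
have [mnow mbatch mstart] := measurable_async_run hK tie mx j.
apply: fibers_measurable_ffun => w; apply: fibers_measurable_bool.
apply: measurable_fun_ltr; first exact: measurable_funD.
exact: measurable_finish_time.
Qed.

Lemma fibers_measurable_batch w : fibers_measurable (fun u => batch (run (xat u)) w).
Proof.
have [_ mbatch _] := measurable_async_run hK tie mx j.
rewrite (_ : (fun u => _) = fun u => [ffun v => batch (run (xat u)) v] w).
  exact: (fibers_measurable_comp (fun b : {ffun 'I_P -> nat} => b w) mbatch).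
by apply/funext => u; rewrite ffunE.
Qed.

Lemma measurable_nonneg_family : measurable [set u | forall w m, 0 <= x w m u].
Proof.
rewrite (_ : [set _ | _] = \bigcap_m (\bigcap_(w in [set: 'I_P]) [set u | 0 <= x w m u])).
  apply: bigcapT_measurable => m; apply: fin_bigcap_measurable => // w _.
  by rewrite -[X in measurable X]setTI; apply: measurable_fun_le => //; exact: measurable_cst.
by apply/seteqP; split => [u H m _ w _|u H w m]; [exact: H|exact: H].
Qed.

End MeasurableEvents.

(** Nonnegativity is built in because the run invariants are proved for nonnegative times, while the
    random times are nonnegative only almost surely. *)
Definition awaits w m (z : 'I_P -> bool) (x : 'I_P -> nat -> R) :=
  [/\ forall v n, 0 <= x v n, batch (run x) w = m &
      forall v, v != w -> outlasts x v = z v].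

(* The cylinder sigma-algebra serves as the space of the computation times other
   than the [m]-th of worker [w], so that no product of many copies of [R] is
   needed to integrate over them. *)
Lemma le_awaits w m z :
  (Pr [set u | awaits w m z (fun v n => X (v, n) u) /\
               outlasts (fun v n => X (v, n) u) w] <=
   p * Pr [set u | awaits w m z (fun v n => X (v, n) u)])%E.
Proof.
pose i := (w, m).
pose T1 := g_sigma_algebraType (cylinders X i).
(* The identity is measurable towards the coarser sigma-algebra; seen this way, it is independent of
   [X i]. *)
have [V VE] : exists V : {mfun T >-> T1}, V = id :> (T -> T).
  apply: (@mfunEx _ _ T T1) => _ A mA; rewrite setTI.
  have sub : <<s cylinders X i >> `<=` measurable.
    by apply: smallest_sub; [exact: sigma_algebra_measurable|exact: cylinders_measurable].
  exact: sub.
(* The family with slot [i] replaced by a free real; evaluating at [(V u, X i u)] restores the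
   original times. *)
pose x v n (uy : T1 * R) : R := if (v, n) == i then uy.2 else X (v, n) uy.1.
have mx v n : measurable_fun setT (x v n).
  rewrite /x; have [_|vn] := eqVneq; first exact: measurable_snd.
  apply: (measurableT_comp (f := X (v, n) : T1 -> R)); last exact: measurable_fst.
  move=> _ Y mY; rewrite setTI; apply: sub_sigma_algebra.
  exists [:: (v, n)], (fun=> Y); split=> //; first by rewrite inE eq_sym.
  apply/seteqP; split => [u Yu k /=|u H]; first by rewrite inE => /eqP ->.
  by apply: (H (v, n)); rewrite /= inE.
have xE u v n : x v n (V u, X i u) = X (v, n) u.
  by rewrite /x VE; case: eqP => //= ->.
have xfE u : (fun v n => x v n (V u, X i u)) = (fun v n => X (v, n) u).
  by apply/funext => v; apply/funext => n; rewrite xE.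
pose E (uy : T1 * R) := awaits w m z (fun v n => x v n uy).
pose O (uy : T1 * R) := outlasts (fun v n => x v n uy) w.
have mE : measurable E.
  rewrite (_ : E = [set uy | forall v n, 0 <= x v n uy] `&`
      ((fun uy => batch (run (fun v n => x v n uy)) w) @^-1` [set m]) `&`
      ((fun uy => outlasts (fun v n => x v n uy)) @^-1`
         [set z' | forall v, v != w -> z' v = z v])).
    apply: measurableI; last exact/fibers_measurable_preimage/fibers_measurable_outlasts.
    by apply: measurableI; [exact: measurable_nonneg_family|exact: fibers_measurable_batch].
  by apply/seteqP; split => [uy [? ? ?]|uy [[? ?] ?]].
have mEO : measurable (E `&` [set uy | O uy]).
  apply: measurableI => //.
  have := fibers_measurable_outlasts mx.
  by move/(fibers_measurable_preimage [set z' : {ffun 'I_P -> bool} | z' w]).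
have -> : [set u | awaits w m z (fun v n => X (v, n) u) /\
               outlasts (fun v n => X (v, n) u) w]
    = [set u | (E `&` [set uy | O uy]) (V u, X i u)].
  by apply/funext => u; rewrite /E /O /setI /mkset /= xfE.
have -> : [set u | awaits w m z (fun v n => X (v, n) u)]
    = [set u | E (V u, X i u)].
  by apply/funext => u; rewrite /E /mkset /= xfE.
apply: le_probability_sections => //.
- by move=> A C mA mC; rewrite VE; apply: cylinders_indep.
- by rewrite -(hp i).
move=> v; have [[y0 [Ey0 Oy0]]|noy] := pselect (exists y, (E `&` [set uy | O uy]) (v, y));
    last first.
  rewrite (_ : _ @^-1` _ = set0) ?measure0 ?mule_ge0 -?(hp i)//.
  apply/seteqP; split => // u /= /xsectionP H.
  by apply: noy; exists (X i u).
have xi y : x w m (v, y) = y by rewrite /x eqxx.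
have xoff y y' v' n : (v', n) != i -> x v' n (v, y) = x v' n (v, y').
  by rewrite /x => /negPf ->.
have [pos0 bat0 out0] := Ey0.
set s0 := run (fun v' n => x v' n (v, y0)) in bat0.
pose a0 := now s0 - start s0 w.
have a00 : 0 <= a0.
  by rewrite subr_ge0; case/andP: (async_run_inv hK tie pos0 j w).
have finE y v' : v' != w ->
    finish_time (fun v' n => x v' n (v, y)) s0 v' =
    finish_time (fun v' n => x v' n (v, y0)) s0 v'.
  move=> v'w; rewrite /finish_time (xoff y y0)//.
  by apply: contraNneq v'w => -[-> _].
have mU a : measurable [set u | a < X i u].
  have := @measurable_funPTI _ _ _ _ (X i) `]a, +oo[%classic (measurable_itv _).
  by congr measurable; apply/seteqP; split => u /=; rewrite in_itv/= andbT.
(* Equal counters force the state [s0], where outlasting [t] means exceeding the age by more than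
   [t]. *)
have sub1 : X i @^-1` xsection (E `&` [set uy | O uy]) v `<=`
    [set u | t + a0 < X i u].
  move=> u /= /xsectionP[[_ bat _]]; rewrite /O /= ffunE.
  rewrite (async_run_eq_batch hK _ bat0 bat); last by move=> ? ?; apply: xoff.
  by rewrite /finish_time -/s0 bat0 xi /a0 addrA ltrBlDr (addrC t) (addrC _ (start _ _)).
(* Conversely, any time beyond the age leaves the run at [s0], and it is nonnegative because [a0]
   is. *)
have sub2 : [set u | a0 < X i u] `<=` X i @^-1` xsection E v.
  move=> u /= late; apply/xsectionP; rewrite /E.
  have sE : run (fun v' n => x v' n (v, X i u)) = s0.
    apply: (async_run_eq_late hK pos0 _ bat0); last by rewrite xi.
    by move=> ? ?; apply: xoff.
  split; [|by rewrite sE|].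
    move=> v' n; rewrite /x; case: eqP => [_|/eqP v'i].
      by rewrite /= (le_trans a00)// ltW.
    by have := pos0 v' n; rewrite /x (negPf v'i).
  by move=> v' v'w; rewrite -out0// !ffunE sE finE.
have le1 : (Pr [set u | (t + a0 < X i u)%R] <= p * Pr [set u | (a0 < X i u)%R])%E.
  by rewrite -(hp i); apply: new_longer_than_used_tail.
apply: (@le_trans _ _ (Pr [set u | t + a0 < X i u])).
  apply: le_measure; rewrite ?inE//.
  by apply: measurable_funPTI; apply: measurable_xsection.
apply: (le_trans le1); apply: lee_wpmul2l; first by rewrite -(hp i).
apply: le_measure; rewrite ?inE//.
by apply: measurable_funPTI; apply: measurable_xsection.
Qed.

Let mX w m : measurable_fun setT (X (w, m)).
Proof. exact: measurable_funPT. Qed.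

Lemma ae_nonneg_family : {ae Pr, forall u, forall w m, 0 <= X (w, m) u}.
Proof.
have H (m : nat) : {ae Pr, forall u, forall w, 0 <= X (w, m) u}.
  by apply: filter_forall => w; have [] := hnl (w, m).
by have := ae_foralln H; apply: filterS => u Hu w m; exact: Hu.
Qed.

(** Sums [le_awaits] over the possible mini-batch indices of [w], inside the almost sure event that
    all times are nonnegative. *)
Lemma le_outlasts w (z : 'I_P -> bool) :
  (Pr [set u | outlasts (fun v n => X (v, n) u) w /\
               forall v, v != w -> outlasts (fun v n => X (v, n) u) v = z v] <=
   p * Pr [set u | forall v, v != w -> outlasts (fun v n => X (v, n) u) v = z v])%E.
Proof.
have mout := fibers_measurable_outlasts mX.
set D1 := [set u | _ /\ _]; set D := [set u | _].
have mD : measurable D.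
  exact: (fibers_measurable_preimage
    [set z' : {ffun 'I_P -> bool} | forall v, v != w -> z' v = z v] mout).
have mD1 : measurable D1.
  exact: (fibers_measurable_preimage [set z' : {ffun 'I_P -> bool} |
    z' w /\ forall v, v != w -> z' v = z v] mout).
pose G := [set u | forall w m, 0 <= X (w, m) u].
have mG : measurable G by exact: measurable_nonneg_family mX.
(* After [j] updates a counter is at most [j], so [inord] truncates nothing and the sum is
   finite. *)
pose f u : 'I_j.+1 := inord (batch (run (fun v n => X (v, n) u)) w).
have mf : fibers_measurable f.
  exact: (fibers_measurable_comp (fun b : nat => inord b : 'I_j.+1)
    (fibers_measurable_batch mX w)).
have fE u (m : 'I_j.+1) : (f u = m) <-> batch (run (fun v n => X (v, n) u)) w = m.
  split => [<-|bm]; first by rewrite inordK// ltnS batch_async_run_le.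
  by apply: val_inj; rewrite /f /= bm inordK.
(* Intersecting with [G] must preserve the probability on the left; on the right, monotonicity
   suffices. *)
have DG1 : Pr D1 = Pr (D1 `&` G).
  have [N [mN N0 GN]] := ae_nonneg_family.
  have -> : Pr D1 = (Pr (D1 `\` G) + Pr (D1 `&` G))%E by exact: measureDI.
  have -> : Pr (D1 `\` G) = 0%E; last by rewrite add0e.
  apply: (subset_measure0 _ mN _ N0); first exact: measurableD.
  by move=> u [_ nG]; apply: GN.
apply: (@le_trans _ _ (p * Pr (D `&` G))%E); last first.
  apply: lee_wpmul2l; first by rewrite -(hp (w, 0%N)).
  by apply: le_measure; rewrite ?inE//; apply: measurableI.
have p0 : (0 <= p)%E by rewrite -(hp (w, 0%N)).
rewrite DG1 (probability_finite_split Pr mf (measurableI _ _ mD1 mG)).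
rewrite (probability_finite_split Pr mf (measurableI _ _ mD mG)).
rewrite ge0_sume_distrr//; apply: lee_sum => m _.
have := le_awaits w m z; congr (_ <= p * _)%E; congr (Pr _);
  apply/seteqP; split => u /=.
- by move=> [[pos /fE bat out] ow].
- by move=> [[[ow out] pos] /fE bat].
- by move=> [pos /fE bat out].
- by move=> [[out pos] /fE bat].
Qed.

End Domination.

(** * Tails and expectations *)

Lemma fiber_upd (T : Type) (I : finType) (f : T -> {ffun I -> bool}) z w b :
  f @^-1` [set upd z w b] = [set u | f u w = b /\ forall v, v != w -> f u v = z v].
Proof.
apply/seteqP; split => u /= => [->|[fw fv]].
  by split => [|v /negPf vw]; rewrite ffunE ?eqxx ?vw.
by apply/ffunP => v; rewrite ffunE; case: eqP => [->//|/eqP]; exact: fv.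
Qed.

Section Fibers.
Context d (T : measurableType d) (R : realType) (Pr : probability T R).
Variables (I : finType) (f : T -> {ffun I -> bool}).
Hypothesis mf : fibers_measurable f.
Let q z := fine (Pr (f @^-1` [set z])).

(** The two fibers partition the event that prescribes all coordinates other than [w]. *)
Lemma sum_fibers_upd w z : q (upd z w true) + q (upd z w false) =
  fine (Pr [set u | forall v, v != w -> f u v = z v]).
Proof.
rewrite /q -fineD ?fin_num_measure// -measureU//.
  congr (fine (Pr _)); rewrite !fiber_upd; apply/seteqP; split => u /=.
    by case=> -[].
  by case: (f u w); [left|right].
apply/seteqP; split => // u; rewrite !fiber_upd => -[/= [-> _]].
by case.
Qed.

Lemma sum_fibers : \sum_z q z = 1.
Proof.
have := probability_discrete Pr mf predT.
rewrite (_ : [set _ | _] = setT) ?probability_setT; last by apply/seteqP; split.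
by move=> /= ->; apply: eq_bigr => z _; rewrite mulr1.
Qed.

End Fibers.

Section OrderStatisticTail.
Context d (T : measurableType d) (R : realType) (Pr : probability T R).
Variables (I : finType) (Y : I -> {RV Pr >-> R}).
Hypothesis hY : mutually_independent Y.
Variable t : R.
Let exceeds u : {ffun I -> bool} := [ffun w => t < Y w u].

Lemma measurable_exceeds : fibers_measurable exceeds.
Proof.
apply: fibers_measurable_ffun => w; apply: fibers_measurable_bool.
by apply: measurable_fun_ltr => //; exact: measurable_cst.
Qed.

(** For independent variables the one-coordinate comparison is an equality, which supplies the
    condition on [q'] in [le_mean_nondecr]. *)
Lemma probability_exceeds w (z : I -> bool) :
  Pr [set u | exceeds u w = true /\ forall v, v != w -> exceeds u v = z v] =
  (Pr [set u | (t < Y w u)%R] *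
   Pr [set u | forall v, v != w -> exceeds u v = z v])%E.
Proof.
pose B v := [set y : R | (t < y) = if v == w then true else z v].
have mB v : measurable (B v).
  have : fibers_measurable (fun y : R => t < y).
    by apply: fibers_measurable_bool; apply: measurable_fun_ltr => //; exact: measurable_cst.
  exact.
pose s := [seq v <- enum I | v != w].
have us : uniq s by rewrite filter_uniq ?enum_uniq.
have ws : w \notin s by rewrite mem_filter eqxx.
have vs v : (v \in s) = (v != w) by rewrite mem_filter mem_enum andbT.
have -> : [set u | exceeds u w = true /\ forall v, v != w -> exceeds u v = z v]
    = \bigcap_(v in [set` w :: s]) (Y v @^-1` B v).
  apply/seteqP; split => [u [uw uv] v /= _|u H].
    by rewrite /B /=; case: eqP => [->|/eqP /uv]; [move: uw|]; rewrite ffunE.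
  split=> [|v vw]; rewrite ffunE.
    by have := H w; rewrite /= inE eqxx /B /= eqxx; apply.
  by have := H v; rewrite /= inE vs vw orbT /B /= (negPf vw); apply.
have -> : [set u | forall v, v != w -> exceeds u v = z v]
    = \bigcap_(v in [set` s]) (Y v @^-1` B v).
  apply/seteqP; split => [u uv v /=|u H v vw].
    by rewrite vs /B /= => vw; rewrite (negPf vw) -uv// ffunE.
  by rewrite ffunE; have := H v; rewrite /= vs vw /B /= (negPf vw); apply.
rewrite !hY//= ?ws// big_cons; congr (Pr _ * _)%E.
by apply/seteqP; split => u; rewrite /B /= eqxx.
Qed.

End OrderStatisticTail.

(** * Expectations of positive parts *)

Section Expectation.
Context d (T : measurableType d) (R : realType) (Pr : probability T R).

Lemma measurable_fun_posr (f : T -> R) :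
  measurable_fun setT f -> measurable_fun setT (fun u => Num.max (f u) 0).
Proof. by move=> mf; apply: measurable_maxr => //; exact: measurable_cst. Qed.

(** The expectation subtracts the integral of the negative part, which is nonnegative. This serves
    for the runtime, which may be negative on a null set. *)
Lemma expectation_le_pos (f g : {RV Pr >-> R}) :
  (forall u, g u = Num.max (f u) 0) -> ('E_Pr[f] <= 'E_Pr[g])%E.
Proof.
move=> gE; rewrite !expectation_def integralE -[leRHS]sube0.
apply: leeB; last by apply: integral_ge0.
rewrite le_eqVlt; apply/orP; left; apply/eqP; apply: eq_integral => u _.
by rewrite funeposE gE EFin_max.
Qed.

Lemma expectation_eq_pos (f g : {RV Pr >-> R}) : {ae Pr, forall u, 0 <= f u} ->
  (forall u, g u = Num.max (f u) 0) -> ('E_Pr[f] = 'E_Pr[g])%E.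
Proof.
move=> f0 gE; rewrite !expectation_def; apply: ae_eq_integral => //.
- exact/measurable_EFinP.
- exact/measurable_EFinP.
- by apply: filterS f0 => u fu _; rewrite gE max_l.
Qed.

End Expectation.

Section Tail.
Context (R : realType) (P K : nat) (hK : (1 <= K <= P)%N).
Context d (T : measurableType d) (Pr : probability T R).
Variable X : 'I_P * nat -> {RV Pr >-> R}.
Hypothesis hX : mutually_independent X.
Hypothesis hnl : forall i, new_longer_than_used (X i).
Variable tie : ('I_P -> nat) -> {perm 'I_P}.
Context d' (T' : measurableType d') (Pr' : probability T' R).
Variable Y : 'I_P -> {RV Pr' >-> R}.
Hypotheses (hY : iid Y) (hXY : forall i w, same_distribution (X i) (Y w)).

(** Both events say that fewer than [K] coordinates of a boolean vector are false, a nondecreasing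
    condition, so [le_mean_nondecr] compares them; [le_outlasts] and [probability_exceeds] give its
    hypotheses. *)
Lemma le_tail (j : nat) (t : R) : 0 <= t ->
  (Pr [set u | (t < iteration_runtime K (fun w m => X (w, m) u) tie j)%R] <=
   Pr' [set u | (t < order_statistic K (fun w => Y w u))%R])%E.
Proof.
move=> t0; have /andP[K0 KP] := hK; have [hYi hYd] := hY.
pose w0 := Ordinal (leq_trans K0 KP).
(* All the variables share one law, so [w0] can represent any of them; it exists because [P] is at
   least 1. *)
pose p := fine (Pr' [set u | t < Y w0 u]).
have mgt : measurable [set y : R | t < y].
  have := @measurable_itv R (Interval (BRight t) +oo%O).
  by congr measurable; apply/seteqP; split => x /=; rewrite in_itv/= andbT.
have mY : measurable [set u | t < Y w0 u] by exact: (measurable_funPTI (Y w0) mgt).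
have pE : p%:E = Pr' [set u | t < Y w0 u] by rewrite fineK// fin_num_measure.
have hp i : Pr [set u | t < X i u] = p%:E by rewrite pE; exact: (hXY i w0 mgt).
have hp' w : Pr' [set u | t < Y w u] = p%:E by rewrite pE; exact: (hYd w w0 _ mgt).
have p01 : 0 <= p <= 1.
  by rewrite -!lee_fin pE measure_ge0 probability_le1.
pose f u := outlasts K tie j t (fun w m => X (w, m) u).
pose g u : {ffun 'I_P -> bool} := [ffun w => t < Y w u].
have mf : fibers_measurable f.
  by apply: (fibers_measurable_outlasts hK) => w m; exact: measurable_funPT.
have mg : fibers_measurable g := measurable_exceeds Y t.
pose few (z : {ffun 'I_P -> bool}) := (#|[pred w | ~~ z w]| < K)%N.
have -> : [set u | t < iteration_runtime K (fun w m => X (w, m) u) tie j] =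
    [set u | few (f u)].
  by apply/funext => u; rewrite /mkset lt_iteration_runtime.
have -> : [set u | t < order_statistic K (fun w => Y w u)] = [set u | few (g u)].
  apply/funext => u; rewrite /mkset order_statistic_gt// /few.
  by congr (is_true (_ < _)%N); apply: eq_card => w; rewrite !inE ffunE.
have mfew : measurable [set u | few (f u)].
  exact: (fibers_measurable_preimage [set z | few z]).
have mfew' : measurable [set u | few (g u)].
  exact: (fibers_measurable_preimage [set z | few z]).
rewrite -[leLHS]fineK ?fin_num_measure// -[leRHS]fineK ?fin_num_measure// lee_fin.
rewrite (probability_discrete Pr mf few) (probability_discrete Pr' mg few).
apply: (le_mean_nondecr p01) => //.
- exact: few_false_nondecr.
- move=> w z; rewrite sum_fibers_upd// fiber_upd -lee_fin EFinM.
  rewrite !fineK ?fin_num_measure//.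
  + by rewrite -pE; exact: (le_outlasts hK hX hnl tie j t0 hp).
  + exact: (fibers_measurable_preimage
      [set z' : {ffun 'I_P -> bool} | forall v, v != w -> z' v = z v] mf).
  + exact: (fibers_measurable_preimage [set z' : {ffun 'I_P -> bool} |
      z' w = true /\ forall v, v != w -> z' v = z v] mf).
- move=> w z; rewrite sum_fibers_upd// fiber_upd.
  by rewrite probability_exceeds// hp' fineM// fin_num_measure//;
    exact: (fibers_measurable_preimage
      [set z' : {ffun 'I_P -> bool} | forall v, v != w -> z' v = z v] mg).
- exact: sum_fibers.
- exact: sum_fibers.
Qed.

End Tail.

(** Almost sure membership depends only on the law: the complement of [B] is null for both
    variables. It carries nonnegativity from [X] to [Y]. *)
Lemma ae_same_distribution d (T : measurableType d) d' (T' : measurableType d')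
    (R : realType) (Pr : probability T R) (Pr' : probability T' R)
    (U : {RV Pr >-> R}) (V : {RV Pr' >-> R}) (B : set R) :
    same_distribution U V -> measurable B ->
  {ae Pr, forall u, B (U u)} -> {ae Pr', forall u, B (V u)}.
Proof.
move=> UV mB nU; have mC : measurable (~` B) by exact: measurableC.
have U0 : Pr (U @^-1` ~` B) = 0%E.
  by apply: measure_negligible => //; exact: measurable_funPTI.
apply/(negligibleP Pr' (A := V @^-1` ~` B)); first exact: measurable_funPTI.
by rewrite -U0; apply/esym/(UV _ mC).
Qed.

Theorem lemma3 (R : realType) (P K : nat) (hK : (1 <= K <= P)%N)
  (d : measure_display) (T : measurableType d) (Pr : probability T R)
  (X : 'I_P * nat -> {RV Pr >-> R})
  (hX : iid X) (hnl : forall i, new_longer_than_used (X i))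
  (tie : ('I_P -> nat) -> {perm 'I_P})
  (d' : measure_display) (T' : measurableType d') (Pr' : probability T' R)
  (Y : 'I_P -> {RV Pr' >-> R})
  (hY : iid Y) (hXY : forall i w, same_distribution (X i) (Y w))
  (j : nat) :
  ('E_Pr[(fun omega =>
            iteration_runtime K (fun w m => X (w, m) omega) tie j)]
     <= 'E_Pr'[(fun omega => order_statistic K (fun w => Y w omega))])%E.
Proof.
have mrun : measurable_fun setT
    (fun u => iteration_runtime K (fun w m => X (w, m) u) tie j).
  by apply: measurable_iteration_runtime => // w m; exact: measurable_funPT.
have mord : measurable_fun setT (fun u => order_statistic K (fun w => Y w u)).
  by apply: measurable_order_statistic => // w; exact: measurable_funPT.
have [f fE] := mfunEx mrun; have [g gE] := mfunEx mord.
(* The formula for an expectation as the integral of its tail asks for nonnegativity everywhere,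
   hence the positive parts [f'] and [g']. *)
have [f' f'E] := mfunEx (measurable_fun_posr mrun).
have [g' g'E] := mfunEx (measurable_fun_posr mord).
rewrite -fE -gE; apply: (@le_trans _ _ ('E_Pr[f'])%E).
  by apply: expectation_le_pos => u; rewrite f'E fE.
rewrite (@expectation_eq_pos _ _ _ _ g g'); first last.
- by move=> u; rewrite g'E gE.
- have Y0 w : {ae Pr', forall u, 0 <= Y w u}.
    apply: (ae_same_distribution (B := [set r | 0 <= r]) (hXY (w, 0%N) w)).
      have := @measurable_itv R `[0, +oo[.
      by congr measurable; apply/seteqP; split => r /=; rewrite in_itv/= andbT.
    by have [] := hnl (w, 0%N).
  have : {ae Pr', forall u, forall w, 0 <= Y w u} by apply: filter_forall.
  apply: filterS => u Yu; rewrite gE.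
  by have [w ->] := order_statistic_attained hK (fun w => Y w u).
rewrite !ge0_expectation_ccdf; first last.
- by move=> u; rewrite g'E le_max lexx orbT.
- by move=> u; rewrite f'E le_max lexx orbT.
(* At nonnegative levels a variable and its positive part have the same tail. *)
have ccdfE d1 (T1 : measurableType d1) (Q : probability T1 R) (h h' : {RV Q >-> R}) r :
    0 <= r -> (forall u, h' u = Num.max (h u) 0) ->
    ccdf h' r = Q [set u | (r < h u)%R].
  move=> r0 hh'; rewrite /ccdf /distribution /pushforward; congr (Q _).
  by apply/seteqP; split => u /=; rewrite in_itv/= andbT hh' lt_max (ltNge r 0) r0 orbF.
apply: ge0_le_integral => //.
- by apply: measurable_funTS; exact: ccdf_measurable.
- by apply: measurable_funTS; exact: ccdf_measurable.
move=> r /=; rewrite in_itv/= andbT => r0.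
rewrite (ccdfE _ _ _ f)// ?(ccdfE _ _ _ g)//; first last.
- by move=> u; rewrite f'E fE.
- by move=> u; rewrite g'E gE.
rewrite fE gE; apply: le_tail => //.
by case: hX.
Qed.
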